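(* Let $\Lambda,\Omega>0$ with $2\Omega\Lambda<1$, let $s\in\mathbb N$, and let $\mu\in S_{[0,\Lambda]}$ be a complex measure with support of size $s$. Let $d\ge 3$ and let $\Gamma=(V,E)$ be a $d$-regular Ramanujan graph whose vertex set $V=\{v_1,\dots,v_n\}$ consists of $n$ points in $[-\Omega,\Omega]$, where $$n>\frac{6d\,(1+6/\ln(s/(\Lambda\Omega)))\,s}{d-2\sqrt{d-1}}.$$ Then the $M=(d+1)n$ magnitude measurements $\mathcal M_{0,\Gamma}(\hat\mu),\mathcal M_{1,\Gamma}(\hat\mu),\mathcal M_{2,\Gamma}(\hat\mu)$ determine $[\mu]$; that is, if $\nu\in S_{[0,\Lambda],s}$ satisfies $\mathcal M_{i,\Gamma}(\hat\nu)=\mathcal M_{i,\Gamma}(\hat\mu)$ for $i=0,1,2$, then $\nu=u\mu$ for some $u\in\mathbb C$ with $|u|=1$.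
   Context: For $\Lambda>0$ and $s\in\mathbb N$, $S_{[0,\Lambda],s}$ is the set of complex measures $\mu=\sum_{j=1}^s c_j\delta_{t_j}$ with $c\in\mathbb C^s$ (coefficients may vanish) and $0\le t_1<\dots<t_s\le\Lambda$, where $\delta_t$ is the Dirac measure at $t$; $S_{[0,\Lambda]}=\bigcup_{s\ge1}S_{[0,\Lambda],s}$. The Fourier transform is $\hat\mu(\omega)=\sum_{j=1}^s c_j e^{-2\pi i\omega t_j}$, $\omega\in\mathbb R$. Write $\mu\sim\nu$ if $\mu=u\nu$ with $u\in\mathbb C$, $|u|=1$; $[\mu]$ is the equivalence class of $\mu$. For a finite simple graph $\Gamma=(V,E)$ whose vertices are distinct real numbers $V=\{v_1,\dots,v_n\}$ and a function $g:\mathbb R\to\mathbb C$, define $\mathcal M_{0,\Gamma}(g)=(|g(v_j)|^2)_{j=1}^n$, $\mathcal M_{1,\Gamma}(g)=(|g(v_j)-g(v_k)|^2)_{\{v_j,v_k\}\in E,\,j<k}$, and $\mathcal M_{2,\Gamma}(g)=(|g(v_j)-i\,g(v_k)|^2)_{\{v_j,v_k\}\in E,\,j<k}$. The normalized Laplace operator of a $d$-regular finite graph $\Gamma$ is $L_\Gamma\varphi(v)=\varphi(v)-\frac1d\sum_{\{v,w\}\in E}\varphi(w)$ on $\ell^2(V)$, and $\lambda_1(L_\Gamma)$ is its smallest nonzero eigenvalue. For an integer $d\ge3$, a $d$-regular connected finite graph $\Gamma$ is called a Ramanujan graph if $\lambda_1(L_\Gamma)\ge 1-\frac{2\sqrt{d-1}}{d}$.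 *)

(* Defs.v *)
From HB Require Import structures.
From mathcomp Require Import all_boot all_order all_algebra.
From mathcomp Require Import all_classical all_reals all_analysis.
From mathcomp Require Import complex.

Set Implicit Arguments.
Unset Strict Implicit.
Unset Printing Implicit Defensive.

Import Order.TTheory GRing.Theory Num.Theory.
Local Open Scope classical_set_scope.
Local Open Scope ring_scope.
Local Open Scope complex_scope.

(* Complex measures on R are represented as set functions [set R -> R[i]].
   Like the measures of the library they are total functions; a combination of
   Dirac measures makes sense on every subset of R, and two such combinations
   that agree on Borel sets (even on singletons) agree on all sets. *)
Section discrete_measures.
Variable R : realType.

Definition dirac_comb (s : nat) (c : 'I_s -> R[i]) (t : 'I_s -> R) :
    set R -> R[i] :=
  fun A => \sum_(j < s) c j * (fine (\d_(t j) A : \bar R))%:C.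

(* S_{[0,Lambda],s}; the coefficients may vanish *)
Definition Sn (Lambda : R) (s : nat) : set (set R -> R[i]) :=
  [set mu | exists (c : 'I_s -> R[i]) (t : 'I_s -> R),
     [/\ forall j k : 'I_s, (j < k)%N -> t j < t k,
         forall j, 0 <= t j <= Lambda
       & mu = dirac_comb c t]].

(* S_{[0,Lambda]} *)
Definition Sall (Lambda : R) : set (set R -> R[i]) :=
  \bigcup_(s in [set s : nat | (0 < s)%N]) Sn Lambda s.

(* For a finite combination of Dirac measures the support is the finite set of
   its atoms. *)
Definition msupp (mu : set R -> R[i]) : set R := [set t | mu [set t] != 0].

(* e^{i x} *)
Definition cis (x : R) : R[i] := cos x +i* sin x.

(* Sum over the atoms of mu, so that the transform depends on the measure only
   and not on the way it is written; see [fourier_dirac_comb]. *)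
Definition fourier (mu : set R -> R[i]) (w : R) : R[i] :=
  \sum_(t \in msupp mu) mu [set t] * cis (- (2 * pi * w * t)).

End discrete_measures.

(* A graph whose vertices are n distinct real numbers v_1, ..., v_n is given by
   an injective v : 'I_n -> R together with the adjacency relation e on the
   indices. *)
Section graphs.
Variables (R : realType) (n : nat).
Implicit Types (e : rel 'I_n) (d : nat).

Definition simple_graph e := symmetric e /\ irreflexive e.

Definition regular_graph d e := forall x, #|[pred y | e x y]| = d.

Definition connected_graph e := forall x y, connect e x y.

(* Functions on V are row vectors indexed by the vertices. *)
Definition laplacian d e (phi : 'rV[R[i]]_n) : 'rV[R[i]]_n :=
  \row_x (phi 0 x - d%:R^-1 * \sum_(y | e x y) phi 0 y).

(* The spectrum is real since the Laplacian is self-adjoint, hence l : R. *)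
Definition laplacian_eigenvalue d e (l : R) : Prop :=
  eigenvalue (lin1_mx (laplacian d e)) l%:C.

(* l is lambda_1, the smallest nonzero eigenvalue *)
Definition is_lambda1 d e (l : R) : Prop :=
  [/\ l != 0, laplacian_eigenvalue d e l
    & forall m : R, m != 0 -> laplacian_eigenvalue d e m -> l <= m].

Definition ramanujan d e : Prop :=
  [/\ (3 <= d)%N, simple_graph e, regular_graph d e, connected_graph e
    & exists2 l : R, is_lambda1 d e l
                   & 1 - 2 * Num.sqrt (d%:R - 1) / d%:R <= l].

(* the edges {v_j, v_k}, listed once each with j < k *)
Definition edge e := {p : 'I_n * 'I_n | e p.1 p.2 && (p.1 < p.2)%N}.

Variables (v : 'I_n -> R) (e : rel 'I_n) (g : R -> R[i]).

Definition meas0 : {ffun 'I_n -> R[i]} := [ffun j => `|g (v j)| ^+ 2].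

Definition meas1 : {ffun edge e -> R[i]} :=
  [ffun p => `|g (v (val p).1) - g (v (val p).2)| ^+ 2].

Definition meas2 : {ffun edge e -> R[i]} :=
  [ffun p => `|g (v (val p).1) - 'i%C * g (v (val p).2)| ^+ 2].

End graphs.

Section sanity.
Variable R : realType.

Lemma dirac_comb_set1 s (c : 'I_s -> R[i]) (t : 'I_s -> R) (x : R) :
  dirac_comb c t [set x] = \sum_(j < s | t j == x) c j.
Proof.
rewrite /dirac_comb [RHS]big_mkcond; apply: eq_bigr => j _.
by rewrite diracE /= in_set1; case: eqP => _; rewrite ?mulr1 ?mulr0.
Qed.

Lemma fourier_dirac_comb s (c : 'I_s -> R[i]) (t : 'I_s -> R) (w : R) :
  injective t ->
  fourier (dirac_comb c t) w = \sum_(j < s) c j * cis (- (2 * pi * w * t j)).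
Proof.
move=> t_inj; set F := fun x => dirac_comb c t [set x] * cis (- (2 * pi * w * x)).
have Fj j : dirac_comb c t [set t j] = c j.
  by rewrite dirac_comb_set1 (eq_bigl (pred1 j)) ?big_pred1_eq // => k; apply: inj_eq.
transitivity (\sum_(x \in range t) F x).
  rewrite /fourier; apply: (@fsbig_widen _ _ _ _ (msupp _) (range t)) => x.
    rewrite /msupp /= dirac_comb_set1; apply: contra_neqP => xt.
    by apply: big1 => j /eqP tj; case: xt; exists j.
  case=> _ /= /negP; rewrite negbK => /eqP x0.
  by rewrite x0 mul0r.
rewrite fsbig_image; last by move=> j k _ _; exact: t_inj.
have enumT : [set` enum 'I_s] = [set: 'I_s].
  by apply/seteqP; split=> // j _ /=; rewrite mem_enum.
rewrite -enumT -fsbig_seq ?enum_uniq // big_enum /=.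
by apply: eq_bigr => j _; rewrite /F Fj.
Qed.

Lemma laplacian_is_linear n d (e : rel 'I_n) : linear (laplacian (R := R) d e).
Proof.
move=> a u w; apply/rowP => x; rewrite !mxE.
rewrite (eq_bigr (fun y => a * u 0 y + w 0 y)); last by move=> y _; rewrite !mxE.
rewrite big_split /= -mulr_sumr !mulrDr mulrN opprD addrACA.
by rewrite [_^-1 * (a * _)]mulrCA.
Qed.

HB.instance Definition _ n d (e : rel 'I_n) :=
  GRing.isLinear.Build _ _ _ _ (laplacian (R := R) d e)
    (@laplacian_is_linear n d e).

Lemma laplacian_eigenvalueP n d (e : rel 'I_n) (l : R) :
  laplacian_eigenvalue d e l <->
  exists2 phi : 'rV[R[i]]_n, laplacian d e phi = l%:C *: phi & phi != 0.
Proof.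
have fE (phi : 'rV[R[i]]_n) : phi *m lin1_mx (laplacian d e) = laplacian d e phi.
  exact: mul_rV_lin1.
split=> [/eigenvalueP [phi]|[phi phiE phi0]]; first by rewrite fE; exists phi.
by apply/eigenvalueP; exists phi; rewrite ?fE.
Qed.

End sanity.

(* Main.v *)
Require Import Defs.
From HB Require Import structures.
From mathcomp Require Import all_boot all_order all_algebra.
From mathcomp Require Import all_classical all_reals all_analysis.
From mathcomp Require Import complex ring lra spectral sesquilinear.

(* Deleting from the Ramanujan graph the at most s vertices where the transform
   of mu vanishes leaves a connected component with more than 2 s vertices: by
   the spectral gap many edges leave every small set, while all edges leaving a
   component end in a deleted vertex.  On that component the measurements give
   the products of neighbouring values, hence the two transforms are
   proportional there, and a unimodular combination of mu and nu, with at most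
   2 s atoms, has a transform with more than 2 s zeros.  This is impossible for
   a nonzero combination: an exponential sum with S terms whose frequencies span
   D has at most S zeros on an interval of length less than 2 pi / D.  To see
   this, measure the angular variation of a curve in C along its sample points.
   Passing to the derivative loses at most pi, since the direction of every
   chord lies in the cone of two tangent directions, and between two consecutive
   zeros of a curve its tangent turns by at least pi; on the other hand S - 1
   differentiations, each after a modulation that kills the lowest frequency,
   reduce the sum to a constant. *)

Set Implicit Arguments.
Unset Strict Implicit.
Unset Printing Implicit Defensive.

Import Order.TTheory GRing.Theory Num.Theory.
Import numFieldNormedType.Exports.
Local Open Scope classical_set_scope.
Local Open Scope ring_scope.
Local Open Scope complex_scope.

Local Notation Re := complex.Re.
Local Notation Im := complex.Im.

(** * Unsigned angles between nonzero complex numbers *)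

Section angle.
Variable R : realType.
Implicit Types (u v w z : R[i]) (a b p q t : R).

(* [crs], [acs] and [asn] are the oriented area, cosine and sine of the angle
   from [u] to [w]. *)
Definition dot u w : R := Re u * Re w + Im u * Im w.
Definition crs u w : R := Re u * Im w - Im u * Re w.
Definition nrm u : R := Num.sqrt (dot u u).
Definition acs u w : R := dot u w / (nrm u * nrm w).
Definition asn u w : R := crs u w / (nrm u * nrm w).
Definition ang u w : R := acos (acs u w).

Lemma dot_gt0 u : u != 0 -> 0 < dot u u.
Proof.
case: u => x y; rewrite eq_complex /= negb_and /dot /= => xy.
rewrite -!expr2 lt0r addr_ge0 ?sqr_ge0 // andbT paddr_eq0 ?sqr_ge0 //.
by rewrite !sqrf_eq0 negb_and.
Qed.

Lemma nrm_gt0 u : u != 0 -> 0 < nrm u.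
Proof. by move=> /dot_gt0; rewrite /nrm sqrtr_gt0. Qed.

Lemma sqr_nrm u : nrm u ^+ 2 = dot u u.
Proof. by rewrite sqr_sqrtr // /dot -!expr2 addr_ge0 ?sqr_ge0. Qed.

Lemma acs_asn_sqr u w : u != 0 -> w != 0 -> acs u w ^+ 2 + asn u w ^+ 2 = 1.
Proof.
move=> /nrm_gt0 u0 /nrm_gt0 w0; rewrite /acs /asn !exprMn -mulrDl exprVn.
rewrite exprMn !sqr_nrm.
have -> : dot u w ^+ 2 + crs u w ^+ 2 = dot u u * dot w w by rewrite /dot /crs; ring.
by rewrite divff // -!sqr_nrm mulf_neq0 // expf_neq0 // gt_eqF.
Qed.

Lemma acs_ge_le u w : u != 0 -> w != 0 -> -1 <= acs u w <= 1.
Proof.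
move=> u0 w0; have := acs_asn_sqr u0 w0; have := sqr_ge0 (asn u w).
move=> h1 h2; have : acs u w ^+ 2 <= 1 by lra.
by rewrite -ler_norml -[_ ^+ 2]real_normK ?num_real // expr_le1.
Qed.

Lemma cos_ang u w : u != 0 -> w != 0 -> cos (ang u w) = acs u w.
Proof. by move=> u0 w0; rewrite acosK // in_itv /= acs_ge_le. Qed.

Lemma sin_ang u w : u != 0 -> w != 0 -> sin (ang u w) = `|asn u w|.
Proof.
move=> u0 w0; rewrite sin_acos ?acs_ge_le // -(acs_asn_sqr u0 w0).
by rewrite addrAC subrr add0r sqrtr_sqr.
Qed.

Lemma ang_ge0 u w : u != 0 -> w != 0 -> 0 <= ang u w.
Proof. by move=> u0 w0; rewrite acos_ge0 // acs_ge_le. Qed.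

Lemma ang_le_pi u w : u != 0 -> w != 0 -> ang u w <= pi.
Proof. by move=> u0 w0; rewrite acos_lepi // acs_ge_le. Qed.

Lemma ang_le u w t : u != 0 -> w != 0 -> 0 <= t <= pi -> cos t <= acs u w ->
  ang u w <= t.
Proof.
move=> u0 w0 t0pi; rewrite -cos_ang // leNgt => cos_le; rewrite leNgt; apply: contra cos_le => lt_t.
by rewrite ltr_cos // in_itv //= ang_ge0 // ang_le_pi.
Qed.


(** The addition formula for the signed angles has the product of the sines where
    [cos (ang u v + ang v w)] has its absolute value, so this cosine is at most [acs u w]; a sum
    above [pi] is trivial. *)
Lemma ang_triangle u v w : u != 0 -> v != 0 -> w != 0 ->
  ang u w <= ang u v + ang v w.
Proof.
move=> u0 v0 w0; have := nrm_gt0 u0; have := nrm_gt0 v0; have := nrm_gt0 w0.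
move=> nw nv nu.
have [le_pi|gt_pi] := leP (ang u v + ang v w) pi; last first.
  exact: le_trans (ang_le_pi u0 w0) (ltW gt_pi).
apply: ang_le => //; first by rewrite le_pi addr_ge0 // ang_ge0.
rewrite cosD !cos_ang // !sin_ang // -normrM.
have -> : acs u w = acs u v * acs v w - asn u v * asn v w.
  have nv2 : nrm v ^+ 2 != 0 by rewrite expf_neq0 // gt_eqF.
  apply: (mulfI nv2); rewrite {1}sqr_nrm /acs /asn /dot /crs; field.
  by rewrite !gt_eqF.
by rewrite lerD2l lerN2 ler_norm.
Qed.

(** For [e] in the cone of [u] and [w], both [asn u e] and [asn e w] are nonnegative multiples of
    [asn u w]. Having no opposite signs, they obey the addition formulas also for unsigned angles,
    and the triangle inequality is reversed. *)
Lemma cone_ang u w e a b : u != 0 -> w != 0 -> e != 0 -> 0 <= a -> 0 <= b ->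
  e = a%:C * u + b%:C * w -> ang u e + ang e w <= ang u w.
Proof.
move=> u0 w0 e0 a0 b0 eE.
have := nrm_gt0 u0; have := nrm_gt0 e0; have := nrm_gt0 w0 => nw ne nu.
have de : dot e e = a * dot u e + b * dot e w.
  by rewrite eE; case: (u) (w) => ux uy [wx wy]; rewrite /dot /=; ring.
have cue : crs u e = b * crs u w.
  by rewrite eE; case: (u) (w) => ux uy [wx wy]; rewrite /crs /=; ring.
have cew : crs e w = a * crs u w.
  by rewrite eE; case: (u) (w) => ux uy [wx wy]; rewrite /crs /=; ring.
have ne2 : nrm e ^+ 2 != 0 by rewrite expf_neq0 // gt_eqF.
have acsE : acs u w = acs u e * acs e w - asn u e * asn e w.
  apply: (mulfI ne2); rewrite {1}sqr_nrm /acs /asn /dot /crs; field.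
  by rewrite !gt_eqF.
have asnE : asn u w = asn u e * acs e w + acs u e * asn e w.
  apply: (mulfI ne2); rewrite {1}sqr_nrm /acs /asn /dot /crs; field.
  by rewrite !gt_eqF.
pose c1 := b / (nrm e / nrm w); pose c2 := a / (nrm e / nrm u).
have c1_ge0 : 0 <= c1 by rewrite !divr_ge0 // ltW.
have c2_ge0 : 0 <= c2 by rewrite !divr_ge0 // ltW.
have asue : asn u e = c1 * asn u w.
  by rewrite /asn cue /c1; field; rewrite !gt_eqF.
have asew : asn e w = c2 * asn u w.
  by rewrite /asn cew /c2; field; rewrite !gt_eqF.
clearbody c1 c2.
have cosE : cos (ang u e + ang e w) = acs u w.
  rewrite cosD !cos_ang // !sin_ang // acsE asue asew (normrM c1) (normrM c2).
  rewrite (ger0_norm c1_ge0) (ger0_norm c2_ge0); congr (_ - _).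
  have := real_normK (num_real (asn u w)); rewrite !expr2 => ss.
  by rewrite mulrACA ss mulrACA.
have sin_ge0 : 0 <= sin (ang u e + ang e w).
  rewrite sinD !cos_ang // !sin_ang // asue asew (normrM c1) (normrM c2).
  rewrite (ger0_norm c1_ge0) (ger0_norm c2_ge0).
  have [s0|s0] := ger0P (asn u w).
    by rewrite -asue -asew -asnE.
  suff -> : c1 * - asn u w * acs e w + acs u e * (c2 * - asn u w) =
     - asn u w by rewrite oppr_ge0 ltW.
  by rewrite [RHS](congr1 -%R asnE) asue asew; ring.
(* Strictly between [pi] and [2 * pi] the sine would be negative. A sum of [2 * pi] makes [e]
   opposite to both [u] and [w], which forces [dot e e <= 0]. *)
have le_pi : ang u e + ang e w <= pi.
  rewrite leNgt; apply/negP => gt_pi.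
  have := ang_le_pi u0 e0; have := ang_le_pi e0 w0 => h1 h2.
  have [lt2|ge2] := ltP (ang u e + ang e w) (pi + pi).
    have : 0 < sin (ang u e + ang e w - pi) by apply: sin_gt0_pi; lra.
    by rewrite sinB sinpi cospi; lra.
  have ue : ang u e = pi by lra.
  have ew : ang e w = pi by lra.
  have := cos_ang u0 e0; rewrite ue cospi => /esym acs_ue.
  have := cos_ang e0 w0; rewrite ew cospi => /esym acs_ew.
  have : dot u e = - (nrm u * nrm e).
    by rewrite -mulN1r -acs_ue /acs; field; rewrite !gt_eqF.
  have : dot e w = - (nrm e * nrm w).
    by rewrite -mulN1r -acs_ew /acs; field; rewrite !gt_eqF.
  have p1 : 0 <= nrm u * nrm e by rewrite mulr_ge0 ?ltW.
  have p2 : 0 <= nrm e * nrm w by rewrite mulr_ge0 ?ltW.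
  move=> d1 d2; have := dot_gt0 e0; rewrite de d1 d2.
  have := mulr_ge0 a0 p1; have := mulr_ge0 b0 p2; lra.
rewrite -(@cosK _ (_ + _)) ?cosE // in_itv /= le_pi addr_ge0 ?ang_ge0 //.
Qed.

Lemma ang0 u : u != 0 -> ang u u = 0.
Proof.
move=> u0; rewrite /ang /acs -expr2 sqr_nrm divff ?acos1 //.
by rewrite gt_eqF // dot_gt0.
Qed.

Lemma angN u : u != 0 -> ang u (- u) = pi.
Proof.
move=> u0; rewrite /ang; have -> : acs u (- u) = -1.
  rewrite /acs.
  have -> : nrm (- u) = nrm u by case: u {u0} => x y; rewrite /nrm /dot /= !mulrNN.
  have -> : dot u (- u) = - dot u u by case: u {u0} => x y; rewrite /dot /=; ring.
  by rewrite -expr2 sqr_nrm mulNr divff // gt_eqF // dot_gt0.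
exact: acosN1.
Qed.

Lemma cis_neq0 p : cis p != 0.
Proof.
rewrite eq_complex /=; apply/negP => /andP[/eqP c0 /eqP s0].
by have := cos2Dsin2 p; rewrite c0 s0 expr0n addr0 => /esym/eqP; rewrite oner_eq0.
Qed.

Lemma cisD p q : cis (p + q) = cis p * cis q.
Proof. by rewrite /cis cosD sinD; simpc; congr (_ +i* _); ring. Qed.

Lemma ang_mul_cis p u w : ang (cis p * u) (cis p * w) = ang u w.
Proof.
rewrite /ang /acs.
have dotE x y : dot (cis p * x) (cis p * y) = dot x y.
  have := cos2Dsin2 p; case: x y => x1 x2 [y1 y2]; rewrite /dot /cis /= => h.
  transitivity ((cos p ^+ 2 + sin p ^+ 2) * (x1 * y1 + x2 * y2)); first ring.
  by rewrite h mul1r.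
by rewrite /nrm !dotE.
Qed.

Lemma ang_cis p u : u != 0 -> ang (cis p * u) u <= `|p|.
Proof.
move=> u0; have [le_pi|gt_pi] := leP `|p| pi; last first.
  by apply: le_trans (ang_le_pi _ _) (ltW gt_pi); rewrite ?mulf_neq0 ?cis_neq0.
apply: ang_le; rewrite ?mulf_neq0 ?cis_neq0 ?normr_ge0 //.
have -> : acs (cis p * u) u = cos p.
  rewrite /acs.
  have -> : nrm (cis p * u) = nrm u.
    have := cos2Dsin2 p; case: u {u0} => x1 x2; rewrite /nrm /dot /cis /= => h.
    congr Num.sqrt; transitivity ((cos p ^+ 2 + sin p ^+ 2) * (x1 * x1 + x2 * x2)); first ring.
    by rewrite h mul1r.
  have -> : dot (cis p * u) u = cos p * dot u u.
    by case: u {u0} => x1 x2; rewrite /dot /cis /=; ring.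
  by rewrite -expr2 sqr_nrm mulfK // gt_eqF // dot_gt0.
by have [|] := ger0P p; rewrite ?cosN.
Qed.

(** A common rotation leaves angles unchanged, so only the difference of the two phases counts. *)
Lemma ang_cis2 p q u w : u != 0 -> w != 0 ->
  ang (cis p * u) (cis q * w) <= ang u w + `|q - p|.
Proof.
move=> u0 w0; have -> : cis q * w = cis p * (cis (q - p) * w).
  by rewrite mulrA -cisD addrC subrK.
have zw0 : cis (q - p) * w != 0 by rewrite mulf_neq0 ?cis_neq0.
rewrite ang_mul_cis; apply: le_trans (ang_triangle u0 w0 zw0) _; rewrite lerD2l.
have -> : ang w (cis (q - p) * w) = ang (cis (q - p) * w) w.
  by rewrite /ang /acs /dot; congr (acos (_ / _)); ring.
exact: ang_cis.
Qed.

End angle.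

(** * Angular variation along a finite sequence of points *)

Section path_length.
Variable R : realType.
Implicit Types (u w : R[i]) (l : seq R[i]).

(** The starting direction is a separate argument: it need not lie on the curve that supplies [l],
    and it can be exchanged at the cost of one angle. *)
Fixpoint plen u l : R := if l is w :: l' then ang u w + plen w l' else 0.

Lemma plen_triangle u w l : u != 0 -> w != 0 -> all (fun z => z != 0) l ->
  plen u l <= ang u w + plen w l.
Proof.
move=> u0 w0; case: l => [_|z l /= /andP[z0 _]]; first by rewrite addr0 ang_ge0.
by rewrite addrA lerD2r ang_triangle.
Qed.

End path_length.

(** * A mean value theorem for plane curves *)

Section complex_derivative.
Variable R : realType.
Implicit Types (f g : R -> R[i]) (z e : R[i]) (a b x y : R).

(** Differentiability is tested against every direction [z], so that the real mean value theorem
    applies to each component. *)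
Definition cderiv f g :=
  forall z x, is_derive x 1 (fun y => dot z (f y)) (dot z (g x)).

Lemma dotB z u w : dot z (u - w) = dot z u - dot z w.
Proof. by case: u w => x y [x' y']; rewrite /dot /=; ring. Qed.

Lemma cderiv_MVT f g z a b : cderiv f g -> a < b ->
  exists2 c, a < c < b & dot z (f b - f a) = dot z (g c) * (b - a).
Proof.
move=> fg ab; have [| |c] := @MVT R (fun y => dot z (f y)) (fun y => dot z (g y)) _ _ ab.
- by move=> x _; apply: fg.
- apply: derivable_within_continuous => x _.
  exact: (@ex_derive _ _ _ _ _ _ _ (fg z x)).
by rewrite in_itv /= => cab eq; exists c => //; rewrite dotB.
Qed.

Lemma cderiv_cst0 f g z a b k : cderiv f g ->
  (forall x, a < x < b -> dot z (f x) = k) -> forall x, a < x < b -> dot z (g x) = 0.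
Proof.
move=> fg fk x xab.
have h1 : is_derive x 1 (cst k : R -> R) 0 by exact: is_derive_cst.
rewrite -(@derive_val _ _ _ _ _ _ _ (fg z x)) -(@derive_val _ _ _ _ _ _ _ h1).
apply: near_eq_derive; near=> y.
apply: fk; near: y.
move: xab => /andP[ax xb].
have xab : x \in `]a, b[ by rewrite in_itv /= ax.
by apply: filterS (near_in_itvoo xab) => y; rewrite in_itv.
Unshelve. all: by end_near. Qed.

(** The component along [z] is nonincreasing with equal end values, hence constant. *)
Lemma cderiv_sign f g z a b : cderiv f g -> a < b -> dot z (f b - f a) = 0 ->
  (forall x, a < x < b -> dot z (g x) <= 0) -> forall x, a < x < b -> dot z (g x) = 0.
Proof.
move=> fg ab fab g0.
have mono x y : a <= x -> x < y -> y <= b -> dot z (f y) <= dot z (f x).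
  move=> ax xy yb; have [c /andP[xc cy] eq] := cderiv_MVT z fg xy.
  rewrite -subr_le0 -dotB eq mulr_le0_ge0 ?subr_ge0 ?(ltW xy) //.
  by rewrite g0 // (le_lt_trans ax) //= (lt_le_trans cy).
apply: (cderiv_cst0 (k := dot z (f a)) fg) => x /andP[ax xb].
have := mono _ _ (lexx a) ax (ltW xb); have := mono _ _ (ltW ax) xb (lexx b).
by move/eqP: fab; rewrite dotB subr_eq0 => /eqP ->; lra.
Qed.

(** This is [i * e]; [dot (rot e)] gives the component across [e]. *)
Definition rot e : R[i] := - Im e +i* Re e.

Lemma complex_comb e u w a b : Re e = a * Re u + b * Re w ->
  Im e = a * Im u + b * Im w -> e = a%:C * u + b%:C * w.
Proof. by case: e u w => ? ? [? ?] [? ?] /= -> ->; simpc. Qed.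

(** Cramer's rule in the coordinates along and across [e]. The two vectors lie on different sides of
    the line of [e], and the last inequality, a positive determinant, says that their cone contains
    [e] rather than [- e]. *)
Lemma cone_of_rot (e g1 g2 : R[i]) : e != 0 ->
  dot (rot e) g1 > 0 -> dot (rot e) g2 < 0 ->
  dot e g1 * dot (rot e) g2 < dot e g2 * dot (rot e) g1 ->
  exists k1 k2 : R, [/\ 0 <= k1, 0 <= k2 & e = k1%:C * g1 + k2%:C * g2].
Proof.
move=> e0 q1 q2; rewrite -subr_gt0; set D := _ - _ => D0.
have e2 := dot_gt0 e0.
exists (dot e e / D * - dot (rot e) g2), (dot e e / D * dot (rot e) g1); split.
- by rewrite mulr_ge0 ?divr_ge0 ?oppr_ge0 // ltW.
- by rewrite mulr_ge0 ?divr_ge0 // ltW.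
have Dn0 : D != 0 by rewrite gt_eqF.
have scal x x1 x2 : D * x = dot e e * (- dot (rot e) g2 * x1 + dot (rot e) g1 * x2) ->
    x = dot e e / D * - dot (rot e) g2 * x1 + dot e e / D * dot (rot e) g1 * x2.
  by move=> h; apply: (mulfI Dn0); rewrite h; field.
by apply: complex_comb; apply: scal; rewrite /D /dot /rot /=; ring.
Qed.

Lemma cone_MVT f g a b : cderiv f g -> a < b -> f b - f a != 0 ->
  exists y1 y2 k1 k2, [/\ a < y1, y1 <= y2, y2 < b, 0 <= k1 /\ 0 <= k2 &
    [/\ g y1 != 0, g y2 != 0 & f b - f a = k1%:C * g y1 + k2%:C * g y2]].
Proof.
move=> fg ab; set e := f b - f a => e0.
have e2 := dot_gt0 e0.
have rote : dot (rot e) e = 0 by rewrite /dot /rot /=; ring.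
have neq0 z y : dot z (g y) != 0 -> g y != 0.
  by apply: contra_neq => ->; rewrite /dot /= !mulr0 addr0.
(* A tangent in the very direction of the chord serves as both vectors. *)
have [[y [/andP[ay yb] q0 p0]]|no1] :=
    pselect (exists y, [/\ a < y < b, dot (rot e) (g y) = 0 & 0 < dot e (g y)]).
  exists y, y, (dot e e / dot e (g y)), 0.
  have gy0 : g y != 0 by apply: (neq0 e); rewrite gt_eqF.
  split => //; first by split => //; rewrite divr_ge0 // ltW.
  have pn0 : dot e (g y) != 0 by rewrite gt_eqF.
  have scal x x1 t : dot e (g y) * x = dot e e * x1 + t * dot (rot e) (g y) ->
      x = dot e e / dot e (g y) * x1 + 0 * x1.
    by rewrite q0 => h; apply: (mulfI pn0); rewrite h; field.
  split => //; apply: complex_comb.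
    by apply: (scal _ _ (Im e)); rewrite /dot /rot /=; ring.
  by apply: (scal _ _ (- Re e)); rewrite /dot /rot /=; ring.
have pos1 : exists2 y, a < y < b & 0 < dot e (g y).
  have [c cab] := cderiv_MVT e fg ab; rewrite -/e => eq; exists c => //.
  by rewrite -(pmulr_lgt0 _ (_ : 0 < b - a)) ?subr_gt0 // -eq.
(* The component across the chord has total increment zero. If its derivative were of one sign it
   would vanish identically, and the point of [pos1] would contradict [no1]. *)
have [yp ypab qp] : exists2 y, a < y < b & 0 < dot (rot e) (g y).
  apply: contrapT => no2; have [y yab py] := pos1.
  apply: no1; exists y; split => //.
  apply: (cderiv_sign fg ab) => // x xab; rewrite leNgt; apply/negP => ?.
  by apply: no2; exists x.
have [ym ymab qm] : exists2 y, a < y < b & dot (rot e) (g y) < 0.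
  apply: contrapT => no2; have [y yab py] := pos1.
  apply: no1; exists y; split => //.
  have dN w : dot (- rot e) w = - dot (rot e) w.
    by case: (rot e) w => ? ? [? ?]; rewrite /dot /=; ring.
  apply/eqP; rewrite -oppr_eq0 -dN; apply/eqP.
  apply: (cderiv_sign (z := - rot e) fg ab) => //.
    by rewrite dN -/e rote oppr0.
  move=> x xab; rewrite dN oppr_le0 leNgt; apply/negP => ?.
  by apply: no2; exists x.
suff [y [y' [yab y'ab q1 q2 D]]] : exists y y', [/\ a < y < b, a < y' < b,
    0 < dot (rot e) (g y), dot (rot e) (g y') < 0 &
    dot e (g y) * dot (rot e) (g y') < dot e (g y') * dot (rot e) (g y)].
  have [k1 [k2 [k10 k20 eE]]] := cone_of_rot e0 q1 q2 D.
  move: yab y'ab => /andP[? ?] /andP[? ?].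
  have gy0 : g y != 0 by apply: (neq0 (rot e)); rewrite gt_eqF.
  have gy'0 : g y' != 0 by apply: (neq0 (rot e)); rewrite lt_eqF.
  have [yy'|/ltW y'y] := leP y y'; first by exists y, y', k1, k2.
  by exists y', y, k2, k1; split => //; split => //; rewrite addrC.
apply: contrapT => no2.
have sep y y' : a < y < b -> a < y' < b -> 0 < dot (rot e) (g y) ->
    dot (rot e) (g y') < 0 ->
    dot e (g y) / dot (rot e) (g y) <= dot e (g y') / dot (rot e) (g y').
  move=> yab y'ab q1 q2; rewrite ler_pdivrMr // mulrAC ler_ndivlMr //.
  rewrite leNgt; apply/negP => D; apply: no2; exists y, y'; split => //.
(* If no pair of tangents works, [sep] puts all quotients on the positive side below those on the
   negative side; [sup A] separates the two families. *)
pose A := [set dot e (g y) / dot (rot e) (g y) | y in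
            [set y | a < y < b /\ 0 < dot (rot e) (g y)]].
have Aub y : a < y < b -> dot (rot e) (g y) < 0 ->
    ubound A (dot e (g y) / dot (rot e) (g y)).
  by move=> yab qy _ [y1 [y1ab q1] <-]; apply: sep.
have A0 : A !=set0 by exists (dot e (g yp) / dot (rot e) (g yp)), yp.
have supA : has_sup A by split => //; eexists; exact: Aub ymab qm.
(* Along this direction the chord has component [dot e e > 0], whereas the choice of [sup A] allows
   no tangent a positive component. *)
have [c cab] := cderiv_MVT (e - (sup A)%:C * rot e) fg ab.
have dE w : dot (e - (sup A)%:C * rot e) w = dot e w - sup A * dot (rot e) w.
  by move: (rot e) (e) w => [? ?] [? ?] [? ?]; rewrite /dot /=; ring.
rewrite -/e !dE rote mulr0 subr0 => eq.
have : 0 < dot e (g c) - sup A * dot (rot e) (g c).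
  by rewrite -(pmulr_lgt0 _ (_ : 0 < b - a)) ?subr_gt0 // -eq.
rewrite subr_gt0; case: (ltgtP (dot (rot e) (g c)) 0) => qc.
- rewrite ltNge -ler_ndivlMr //; apply/negP; rewrite negbK.
  by apply: ge_sup => //; apply: Aub.
- rewrite -ltr_pdivlMr // ltNge; apply/negP; rewrite negbK.
  by apply: sup_upper_bound => //; exists c.
- by rewrite qc mulr0 => pc; apply: no1; exists c.
Qed.

End complex_derivative.

(** * Nondecreasing lists of sample points *)

Section sorted_paths.
Variable R : realType.
Implicit Types (x y m : R) (s : seq R).

Lemma le_path_last x s : path <=%R x s -> x <= last x s.
Proof. by elim: s x => //= y s IH x /andP[xy /IH]; apply: le_trans. Qed.

Lemma le_path_widen x y s : x <= y -> path <=%R y s -> path <=%R x s.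
Proof. by case: s => //= z s xy /andP[yz ->]; rewrite (le_trans xy). Qed.

Lemma last_le_widen x y m s : x <= y -> last y s <= m -> last x s <= m.
Proof. by case: s => //= xy; apply: le_trans. Qed.

End sorted_paths.

(** * Angular variation of a curve and of its derivative *)

Section rolle_path.
Variable R : realType.
Variables f g : R -> R[i].
Hypothesis fg : cderiv f g.

Lemma all_neq0_map (h : R -> R[i]) xs : all (fun x => h x != 0) xs ->
  all (fun z => z != 0) (map h xs).
Proof. by rewrite all_map. Qed.

(** Each chord is replaced by the two tangents whose cone contains it. Both paths start at [f x0],
    which makes the induction go through; passing to the first tangent as start later costs at most
    [pi]. *)
Lemma rolle_path x0 xs : path <=%R x0 xs -> f x0 != 0 -> all (fun x => f x != 0) xs ->
  exists ys, [/\ path <=%R x0 ys, last x0 ys <= last x0 xs,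
    all (fun y => g y != 0) ys &
    plen (f x0) (map f xs) <= plen (f x0) (map g ys)].
Proof.
elim: xs x0 => [|x1 xs IH] x0 /=; first by exists [::]; rewrite /= lexx.
move=> /andP[x01 x1xs] f0 /andP[f1 fxs].
have [ys [x1ys lastys gys le]] := IH x1 x1xs f1 fxs.
have [e0|e0] := eqVneq (f x1 - f x0) 0.
  have f10 : f x1 = f x0 by apply/eqP; rewrite -subr_eq0 e0.
  exists ys; split => //.
  - exact: le_path_widen x01 x1ys.
  - exact: last_le_widen x01 lastys.
  - by rewrite -f10 ang0 // add0r.
have lt01 : x0 < x1.
  by rewrite lt_neqAle x01 andbT; apply: contra e0 => /eqP ->; rewrite subrr.
have [y1 [y2 [k1 [k2 [xy1 y12 y2x [k10 k20] [gy1 gy2 eE]]]]]] := cone_MVT fg lt01 e0.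
exists [:: y1, y2 & ys]; split => //=.
- rewrite (ltW xy1) y12 /=; exact: le_path_widen (ltW y2x) x1ys.
- exact: last_le_widen (ltW y2x) lastys.
- by rewrite gy1 gy2.
set P := f x0 in f0 *; set Q := f x1 in f1 *.
have gs := all_neq0_map gys.
(* [Q] is the sum of [P] and the chord, so moving along the chord turns the position towards the
   chord's direction. *)
have h1 : ang P Q + ang Q (Q - P) <= ang P (Q - P).
  apply: (@cone_ang _ _ _ _ 1 1) => //; by rewrite !mul1r addrC subrK.
have h2 := cone_ang gy1 gy2 e0 k10 k20 eE.
have h3 := ang_triangle f0 gy1 e0.
have h4 := plen_triangle f1 e0 gs.
have h5 := plen_triangle e0 gy2 gs.
rewrite -/P -/Q in le h1 h2 h3 h4 h5 *.
lra.
Qed.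

(** Between two zeros the curve visits some [f z != 0]: the chord out is [f z] and the chord back is
    [- f z]. Each lies in a cone of two tangents, so the four tangents turn by at least [pi]. *)
Lemma rolle_zeros x0 xs : path <%R x0 xs -> f x0 = 0 -> all (fun x => f x == 0) xs ->
  (forall x y, x < y -> exists2 z, x < z < y & f z != 0) ->
  exists ys, [/\ path <=%R x0 ys, last x0 ys <= last x0 xs,
    all (fun y => g y != 0) ys &
    forall u, u != 0 -> (size xs)%:R * pi <= plen u (map g ys)].
Proof.
move=> + + + fn0; elim: xs x0 => [|x1 xs IH] x0 /=.
  by exists [::]; split => //= u _; rewrite mul0r.
move=> /andP[x01 x1xs] f0 /andP[/eqP f1 fxs].
have [ys [x1ys lastys gys le]] := IH x1 x1xs f1 fxs.
have [z /andP[x0z zx1] fz] := fn0 _ _ x01.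
have e0 : f z - f x0 != 0 by rewrite f0 subr0.
have e1 : f x1 - f z != 0 by rewrite f1 sub0r oppr_eq0.
have [y1 [y2 [k1 [k2 [xy1 y12 y2x [k10 k20] [gy1 gy2 eE]]]]]] := cone_MVT fg x0z e0.
have [y3 [y4 [k3 [k4 [xy3 y34 y4x [k30 k40] [gy3 gy4 eE']]]]]] := cone_MVT fg zx1 e1.
exists [:: y1, y2, y3, y4 & ys]; split => //=.
- rewrite (ltW xy1) y12 y34 (ltW (lt_trans y2x xy3)) /=.
  exact: le_path_widen (ltW y4x) x1ys.
- exact: last_le_widen (ltW y4x) lastys.
- by rewrite gy1 gy2 gy3 gy4.
move=> u u0; rewrite f0 subr0 in e0 eE; rewrite f1 sub0r in e1 eE'.
have h1 := cone_ang gy1 gy2 e0 k10 k20 eE.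
have h2 := cone_ang gy3 gy4 e1 k30 k40 eE'.
have h3 := ang_triangle e0 gy2 e1; rewrite angN // in h3.
have h4 := ang_triangle gy2 gy3 e1.
have h5 := le _ gy4.
have p1 := ang_ge0 u0 gy1; have p2 := ang_ge0 gy1 e0; have p3 := ang_ge0 e1 gy4.
rewrite -natr1 mulrDl mul1r; lra.
Qed.

End rolle_path.

(** * Angular variation of exponential sums *)

Section exponential_sums.
Variable R : realType.
Implicit Types (l : seq (R[i] * R)) (x y : R).

Definition expsum l x : R[i] := \sum_(p <- l) p.1 * cis (p.2 * x).

Definition dexp l := [seq (p.1 * (p.2)*i, p.2) | p <- l].

Definition freq_shift r l : seq (R[i] * R) := [seq (p.1, p.2 - r) | p <- l].

Lemma cderiv_expsum l : cderiv (expsum l) (expsum (dexp l)).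
Proof.
move=> z x; elim: l => [|[c r] l IH].
  rewrite /expsum; under eq_fun do rewrite big_nil; rewrite big_nil.
  have -> : dot z 0 = 0 by rewrite /dot /= !mulr0 addr0.
  exact: is_derive_cst.
have -> : (fun y => dot z (expsum ((c, r) :: l) y)) =
    (fun y => dot z c * cos (r * y) + dot z (c * 'i%C) * sin (r * y) + dot z (expsum l y)).
  apply/funext => y; rewrite /expsum big_cons /=.
  case: (\sum_(_ <- _) _) => ? ?; case: (c) (z) => ? ? [? ?]; rewrite /dot /cis /=; ring.
have -> : dot z (expsum (dexp ((c, r) :: l)) x) =
    (dot z c * - (r * sin (r * x)) + dot z (c * 'i%C) * (r * cos (r * x))) +
    dot z (expsum (dexp l) x).
  rewrite /expsum big_cons /=.
  case: (\sum_(_ <- _) _) => ? ?; case: (c) (z) => ? ? [? ?]; rewrite /dot /cis /=; ring.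
apply: is_deriveD.
apply: is_derive_eq.
by rewrite /GRing.scale /=; ring.
Qed.

Lemma expsum_shift r l x : expsum l x = cis (r * x) * expsum (freq_shift r l) x.
Proof.
rewrite /expsum big_map mulr_sumr; apply: eq_bigr => -[c s] _ /=.
by rewrite mulrCA -cisD -mulrDl addrC subrK.
Qed.

Lemma map_snd_dexp_shift r l :
  map snd (dexp (freq_shift r l)) = [seq s - r | s <- map snd l].
Proof. by rewrite /dexp /freq_shift -!map_comp; apply: eq_map. Qed.

Lemma expsum_cons0 c l x : expsum (dexp ((c, 0) :: l)) x = expsum (dexp l) x.
Proof. by rewrite /expsum big_cons /= (_ : 0*i = 0) // mulr0 mul0r add0r. Qed.

(** By [ang_cis2] each step gains at most [r] times its length, and the lengths telescope. *)
Lemma plen_cis (f : R -> R[i]) r x0 xs : 0 <= r -> path <=%R x0 xs ->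
  f x0 != 0 -> all (fun x => f x != 0) xs ->
  plen (cis (r * x0) * f x0) [seq cis (r * x) * f x | x <- xs] <=
  plen (f x0) (map f xs) + r * (last x0 xs - x0).
Proof.
move=> r0; elim: xs x0 => [|x1 xs IH] x0 /=; first by rewrite subrr mulr0 addr0.
move=> /andP[x01 x1xs] f0 /andP[f1 fxs].
have := IH _ x1xs f1 fxs.
have := ang_cis2 (r * x0) (r * x1) f0 f1.
by rewrite -mulrBr ger0_norm ?mulr_ge0 ?subr_ge0 //; lra.
Qed.

(* Each differentiation removes one term and costs at most [pi] of angular
   variation, while making the lowest frequency zero costs that frequency times
   the length; the frequency costs add up to the largest frequency. *)
Lemma plen_expsum c r l M x0 xs : 0 <= r -> path <=%R r (map snd l) -> last r (map snd l) <= M ->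
  path <=%R x0 xs -> expsum ((c, r) :: l) x0 != 0 ->
  all (fun x => expsum ((c, r) :: l) x != 0) xs ->
  plen (expsum ((c, r) :: l) x0) (map (expsum ((c, r) :: l)) xs) <=
  (size l)%:R * pi + M * (last x0 xs - x0).
Proof.
move En : (size l) => n; elim: n c r l En M x0 xs => [|n IH] c r l En M x0 xs r0 rl lM x0xs.
all: set F := expsum _; set G := expsum (freq_shift r ((c, r) :: l)).
all: have FG x : F x = cis (r * x) * G x by exact: expsum_shift.
all: have FG0 x : (F x != 0) = (G x != 0) by rewrite FG mulf_eq0 negb_or cis_neq0.
all: rewrite FG0 (eq_all FG0) => G0 Gxs.
all: have -> : map F xs = [seq cis (r * x) * G x | x <- xs] by apply: eq_map.
all: rewrite FG; apply: le_trans (plen_cis r0 x0xs G0 Gxs) _.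
all: have le_last := le_path_last x0xs.
  case: l En rl lM @F @G FG FG0 G0 Gxs => // _ _ rM F G FG FG0 G0 Gxs.
  have GE x : G x = c.
    rewrite /G /expsum /= big_cons big_nil /= subrr mul0r /cis cos0 sin0 addr0.
    by rewrite (_ : 1 +i* 0 = 1) ?mulr1.
  rewrite mul0r add0r.
  have -> : plen (G x0) (map G xs) = 0.
    have -> : map G xs = nseq (size xs) c by elim: (xs) => //= x xs' ->; rewrite GE.
    rewrite GE; rewrite GE in G0; elim: (size xs) => //= k ->; rewrite ang0 //; ring.
  by rewrite add0r ler_wpM2r ?subr_ge0.
have [ys [x0ys lastys gys le]] := rolle_path (cderiv_expsum _) x0xs G0 Gxs.
rewrite -/G in le.
case: l En rl lM @F @G FG FG0 G0 Gxs gys le => // -[c1 r1] l [En] /andP[r01 r1l] lM.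
move=> F G FG FG0 G0 Gxs gys le.
set g := expsum _ in gys le.
pose l1 := dexp (freq_shift r l).
have gE x : g x = expsum ((c1 * (r1 - r)*i, r1 - r) :: l1) x.
  rewrite /g; have -> : freq_shift r ((c, r) :: (c1, r1) :: l) =
    (c, 0) :: (c1, r1 - r) :: freq_shift r l by rewrite /freq_shift /= subrr.
  by rewrite expsum_cons0.
case: ys x0ys lastys gys le => [_ _ _ /= le|y0 ys /= /andP[x0y0 y0ys] lastys /andP[gy0 gys] le].
  have : 0 <= (n.+1%:R : R) * pi by rewrite mulr_ge0 ?pi_ge0.
  have : r * (last x0 xs - x0) <= M * (last x0 xs - x0).
    rewrite ler_wpM2r ?subr_ge0 //; apply: le_trans lM; apply: le_trans r01 _.
    exact: le_path_last r1l.
  lra.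
have l1E := map_snd_dexp_shift r l.
have := @IH (c1 * (r1 - r)*i) (r1 - r) l1 _ (M - r) y0 ys.
rewrite /l1 !size_map En -/l1 l1E (last_map (fun s => s - r)) subr_ge0 r01 lerD2r.
have -> : path <=%R (r1 - r) [seq s - r | s <- map snd l].
  apply: etrans (path_map (f := fun s => s - r) r1 _) _.
  by apply: sub_path r1l => s t /=; rewrite lerD2r.
move=> /(_ erefl isT isT lM y0ys).
rewrite -gE -(eq_all (fun x => congr1 (fun z => z != 0) (gE x))) -(eq_map gE).
move=> /(_ gy0 gys) le2.
(* The path of tangents begins with the angle from [G x0] to [g y0]; this is the [pi] charged to the
   removed term. *)
have le3 := ang_le_pi G0 gy0.
have le4 := le_path_last y0ys.
have : (M - r) * (last y0 ys - y0) <= (M - r) * (last x0 xs - x0).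
  rewrite ler_wpM2l ?lerB // subr_ge0; apply: le_trans lM; apply: le_trans r01 _.
    exact: le_path_last r1l.
rewrite -natr1; lra.
Qed.

End exponential_sums.

(** * Zeros of exponential sums *)

Section zeros.
Variable R : realType.
Implicit Types (l : seq (R[i] * R)) (x y : R).

Lemma dot_eq0 (w : R[i]) : (forall z, dot z w = 0) -> w = 0.
Proof. by move=> /(_ w) /eqP; apply: contraTeq => /dot_gt0 /gt_eqF ->. Qed.

(** Linear independence of exponentials: after a modulation that makes the first frequency zero,
    differentiation removes the first term and multiplies the others by nonzero factors, so
    induction applies. *)
Lemma expsum_inj l a b : a < b -> uniq (map snd l) ->
  (forall x, a < x < b -> expsum l x = 0) -> all (fun p => p.1 == 0) l.
Proof.
move=> ab; move En : (size l) => n; elim: n l En => [|n IH] [|[c r] l] //= [En] /andP[rl ul] l0.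
set G := expsum (freq_shift r ((c, r) :: l)).
have G0 x : a < x < b -> G x = 0.
  move=> /l0; rewrite (expsum_shift r) => /eqP.
  by rewrite mulf_eq0 (negbTE (cis_neq0 _)) => /eqP.
have GE x : G x = c + expsum (freq_shift r l) x.
  by rewrite /G /expsum /= big_cons /= subrr mul0r /cis cos0 sin0 (_ : 1 +i* 0 = 1) ?mulr1.
have c0 x : a < x < b -> expsum (dexp (freq_shift r l)) x = 0.
  move=> xab; apply: dot_eq0 => z.
  have -> : expsum (dexp (freq_shift r l)) x = expsum (dexp (freq_shift r ((c, r) :: l))) x.
    by rewrite /freq_shift /= subrr expsum_cons0.
  apply: (cderiv_cst0 (cderiv_expsum _) _ xab) => y yab.
  by rewrite -/G G0 // /dot /= !mulr0 addr0.
have : all (fun p => p.1 == 0) (dexp (freq_shift r l)).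
  apply: IH => //; first by rewrite !size_map.
  by rewrite map_snd_dexp_shift map_inj_uniq // => s t /addIr.
move=> l10; have l00 : all (fun p => p.1 == 0) l.
  apply/allP => -[c1 r1] in_l; move/allP: l10.
  move/(_ (c1 * (r1 - r)*i, r1 - r)).
  rewrite (_ : _ \in _ = true); last first.
    by apply/mapP; exists (c1, r1 - r) => //; apply/mapP; exists (c1, r1).
  move=> /(_ isT) /=; rewrite mulf_eq0 => /orP[//|].
  rewrite eq_complex /= eqxx /= subr_eq0 => /eqP r1r.
  by case/negP: rl; apply/mapP; exists (c1, r1).
rewrite l00 andbT; have [x xab] : exists x, a < x < b.
  by exists ((a + b) / 2); rewrite midf_lt //= midf_lt.
have := G0 x xab; rewrite GE /expsum big_map big_seq big1 ?addr0 => [->//|].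
by move=> p /(allP l00) /eqP ->; rewrite mul0r.
Qed.

(** A nonzero sum, modulated to lowest frequency zero, has a derivative that turns by at least
    [(size xs)%:R * pi] between its zeros. By [plen_expsum], that derivative turns by at most [pi]
    times ([size l] minus 2), plus [M * (b - a) < 2 * pi]. *)
Lemma expsum_zeros l M a b x0 xs : sorted <%R (map snd l) ->
  all (fun p => 0 <= p.2 <= M) l -> M * (b - a) < 2 * pi ->
  path <%R x0 xs -> a <= x0 -> last x0 xs <= b -> (size l <= size xs)%N ->
  expsum l x0 = 0 -> all (fun x => expsum l x == 0) xs ->
  all (fun p => p.1 == 0) l.
Proof.
case: l => // -[c r] l rl lM Mab x0xs ax0 xsb; case: xs x0xs xsb => // x1 xs x0xs xsb lxs F0 Fxs.
have le_x0 := le_path_last (sub_path (@ltW _ _) x0xs).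
apply: contrapT => /negP cn0.
have fn0 x y : x < y -> exists2 z, x < z < y & expsum ((c, r) :: l) z != 0.
  move=> xy; apply: contrapT => no; move/negP: cn0; apply.
  apply: (expsum_inj xy); first exact: lt_sorted_uniq rl.
  by move=> z xzy; apply: contrapT => /eqP z0; apply: no; exists z.
set G := expsum (freq_shift r ((c, r) :: l)).
have FG x : expsum ((c, r) :: l) x = cis (r * x) * G x by exact: expsum_shift.
have FG0 x : (expsum ((c, r) :: l) x == 0) = (G x == 0).
  by rewrite FG mulf_eq0 (negbTE (cis_neq0 _)).
have Gn0 x y : x < y -> exists2 z, x < z < y & G z != 0.
  by move=> /fn0[z ? zn0]; exists z => //; rewrite -FG0.
have G0 : G x0 = 0 by apply/eqP; rewrite -FG0 F0.
rewrite (eq_all FG0) in Fxs.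
have [ys [x0ys lastys gys le]] := rolle_zeros (cderiv_expsum _) x0xs G0 Fxs Gn0.
have pi0 : 0 < pi :> R by exact: pi_gt0.
case: ys x0ys lastys gys le => [_ _ _ /(_ 1 (oner_neq0 _))|y0 ys].
  by rewrite leNgt mulr_gt0 // ltr0n.
(* With the first tangent itself as starting direction the first angle is zero, so nothing is lost
   here. *)
move=> /andP[xy0 y0ys] lastys /andP[gy0 gys] /(_ _ gy0) /=; rewrite ang0 // add0r.
set g := expsum _ in gy0 gys *.
have gE x : g x = expsum (dexp (freq_shift r l)) x.
  rewrite /g; have -> : freq_shift r ((c, r) :: l) = (c, 0) :: freq_shift r l.
    by rewrite /freq_shift /= subrr.
  by rewrite expsum_cons0.
move: xsb lastys; rewrite [last x0 (x1 :: xs)]/= [last x0 (y0 :: ys)]/= => xsb lastys.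
move: lM rl lxs gE; clearbody g; clear -xy0 gy0 gys Mab xsb ax0 lastys le_x0 y0ys pi0.
case: l => [|[c1 r1] l] lM rl lxs gE.
  by move: gy0; rewrite gE /expsum big_nil eqxx.
have {lM} [/andP[r0 rM] lM] : 0 <= r <= M /\ all (fun p => 0 <= p.2 <= M) ((c1, r1) :: l).
  by case/andP: lM.
pose l2 := dexp (freq_shift r l).
have {}gE x : g x = expsum ((c1 * (r1 - r)*i, r1 - r) :: l2) x by rewrite gE.
have [r01 r1l] : r < r1 /\ path <%R r1 (map snd l) by case/andP: rl.
have l2E := map_snd_dexp_shift r l.
have := @plen_expsum _ (c1 * (r1 - r)*i) (r1 - r) l2 (M - r) y0 ys.
rewrite /l2 !size_map -/l2 l2E (last_map (fun s => s - r)) subr_ge0 (ltW r01) lerD2r.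
have -> : path <=%R (r1 - r) [seq s - r | s <- map snd l].
  apply: etrans (path_map (f := fun s => s - r) r1 _) _.
  by apply: sub_path r1l => s t /ltW /=; rewrite lerD2r.
have lastM : last r1 (map snd l) <= M.
  rewrite (last_map snd l (c1, r1)).
  by have /(allP lM) /andP[] := mem_last (c1, r1) l.
move=> /(_ isT isT lastM y0ys).
rewrite -gE -(eq_all (fun x => congr1 (fun z => z != 0) (gE x))) -(eq_map gE).
move=> /(_ gy0 gys) le2.
have le4 := le_path_last y0ys.
have le5 : (M - r) * (last y0 ys - y0) <= M * (b - a).
  apply: ler_pM; rewrite ?subr_ge0 //; first by rewrite lerBlDr lerDl.
  by apply: lerB; [exact: le_trans lastys _|exact: le_trans ax0 xy0].
apply/negP; rewrite -ltNge.
apply: le_lt_trans le2 _; apply: le_lt_trans (lerD (lexx _) le5) _.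
(* By now [l] lacks the first two terms, so [(size l).+2] is the length of the original sum, which
   [lxs] compares with the zeros after [x0]. *)
apply: lt_le_trans (_ : _ < ((size l).+2)%:R * pi) _.
  by rewrite -addn2 natrD mulrDl ltrD2l.
by apply: ler_wpM2r; [exact: ltW|rewrite ler_nat].
Qed.

End zeros.

(** * Positivity of Hermitian forms from eigenvalues *)

Section spectral_gap.

(** In the coordinates [y] of a unitary diagonalization the form is a sum of squared moduli weighted
    by the diagonal entries; these are real, and each is an eigenvalue with a row of [P] as
    eigenvector. *)
Lemma hermitian_psd (C : numClosedFieldType) n (A : 'M[C]_n) (x : 'rV[C]_n) :
  A \is hermitianmx n false Num.conj ->
  (forall m, m \is Num.real -> eigenvalue A m -> 0 <= m) ->
  0 <= \sum_i \sum_j x 0 i * A i j * (x 0 j)^*.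
Proof.
move=> Ah Aeig; set P := spectralmx A; set D := spectral_diag A.
have Dreal := hermitian_spectral_diag_real Ah.
have AE := orthomx_spectralP (hermitian_normalmx Ah).
have Pu := spectral_unit A; rewrite -/P -/D in AE Dreal Pu.
have D_ge0 j : 0 <= D 0 j.
  apply: Aeig; first by move/mxOverP: Dreal; apply.
  apply/eigenvalueP; exists (row j P).
    by rewrite {1}AE -row_mul !mulmxA mulmxV // mul1mx mul_diag_mx; apply/rowP => k; rewrite !mxE.
  apply: contraTneq Pu => Pj0; rewrite -row_free_unit.
  apply/negP => /row_freeP[B /(congr1 (row j))]; rewrite row_mul Pj0 mul0mx => /rowP /(_ j).
  by rewrite !mxE eqxx => /eqP; rewrite eq_sym oner_eq0.
have -> : \sum_i \sum_j x 0 i * A i j * (x 0 j)^* = (x *m A *m (map_mx Num.conj x^T)) 0 0.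
  rewrite !mxE; under [RHS]eq_bigr do rewrite !mxE mulr_suml.
  by rewrite exchange_big.
pose y := x *m invmx P.
have -> : x *m A *m (map_mx Num.conj x^T) = y *m diag_mx D *m (map_mx Num.conj y^T).
  rewrite {1}AE !mulmxA -/y -!mulmxA; congr (_ *m (_ *m _)).
  by rewrite /y (invmx_unitary (spectral_unitarymx A)) trmx_mul map_mxM trmxCK.
rewrite mul_mx_diag !mxE; apply: sumr_ge0 => j _; rewrite !mxE.
by rewrite mulrAC mulr_ge0 // mul_conjC_ge0.
Qed.

End spectral_gap.

(** * Edge expansion from the spectral gap *)

Section expansion.
Variables (R : realType) (n d : nat) (e : rel 'I_n).
Hypotheses (e_sym : symmetric e) (e_reg : regular_graph d e) (d_gt0 : (0 < d)%N).
Hypothesis e_conn : connected_graph e.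

Let L : 'M[R[i]]_n := lin1_mx (laplacian d e).

Let LE i j : L i j = (i == j)%:R - d%:R^-1 * (e i j)%:R.
Proof.
rewrite /L !mxE eqxx /= [i == j]eq_sym; congr (_ - _ * _).
rewrite big_mkcond (bigD1 i) //= big1 ?addr0 => [|k ki].
  by rewrite mxE !eqxx e_sym; case: (e i j).
by rewrite mxE eqxx /= (negbTE ki); case: ifP.
Qed.

Let mulL (phi : 'rV[R[i]]_n) : phi *m L = laplacian d e phi.
Proof. exact: mul_rV_lin1. Qed.

Lemma sum_edges i : \sum_j (e i j)%:R = d%:R :> R[i].
Proof. by rewrite -natr_sum -(e_reg i) -sum1_card [in RHS]big_mkcond. Qed.

(** The Dirichlet energy of [phi] vanishes, so [phi] is constant along edges and, by connectedness,
    everywhere. *)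
Lemma laplacian_ker (phi : 'rV[R[i]]_n) : laplacian d e phi = 0 ->
  forall x y, phi 0 x = phi 0 y.
Proof.
move=> L0.
have d0 : d%:R != 0 :> R[i] by rewrite pnatr_eq0 -lt0n.
have dphi x : \sum_y (e x y)%:R * (phi 0 x - phi 0 y) = 0.
  have /rowP /(_ x) := L0; rewrite !mxE => h.
  under eq_bigr do rewrite mulrBr.
  rewrite sumrB -mulr_suml sum_edges; apply: (mulfI (invr_neq0 d0)).
  rewrite mulr0 mulrBr mulrA mulVf // mul1r -[RHS]h; congr (_ - _ * _).
  rewrite [RHS]big_mkcond; apply: eq_bigr => y _.
  by case: (e x y); rewrite ?mul1r ?mul0r.
have S0 : \sum_x \sum_y (e x y)%:R * `|phi 0 x - phi 0 y| ^+ 2 = 0.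
  have -> : \sum_x \sum_y (e x y)%:R * `|phi 0 x - phi 0 y| ^+ 2 =
      \sum_x \sum_y (e x y)%:R * (phi 0 x - phi 0 y)^*%R * phi 0 x
    + \sum_x \sum_y (e x y)%:R * (phi 0 y - phi 0 x)^*%R * phi 0 y.
    rewrite -big_split; apply: eq_bigr => x _; rewrite -big_split.
    apply: eq_bigr => y _ /=; rewrite normCK -[phi 0 y - phi 0 x]opprB rmorphN.
    by rewrite mulrN mulNr -mulrA -mulrA -mulrBr; congr (_ * _); rewrite mulrC mulrBr.
  have sum0 x : \sum_y (e x y)%:R * (phi 0 x - phi 0 y)^*%R * phi 0 x = 0.
    rewrite -mulr_suml (_ : \sum_y _ = (\sum_y (e x y)%:R * (phi 0 x - phi 0 y))^*%R).
      by rewrite dphi rmorph0 mul0r.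
    by rewrite rmorph_sum; apply: eq_bigr => y _; rewrite rmorphM rmorph_nat.
  rewrite big1 // add0r exchange_big big1 // => y _.
  by rewrite -[RHS](sum0 y); apply: eq_bigr => x _; rewrite e_sym.
have edge_eq x y : e x y -> phi 0 x = phi 0 y.
  move=> exy; apply/eqP; rewrite -subr_eq0 -normr_eq0 -sqrf_eq0.
  have ge0 u w : 0 <= (e u w)%:R * `|phi 0 u - phi 0 w| ^+ 2 :> R[i].
    by rewrite mulr_ge0 ?ler0n // exprn_ge0.
  have := psumr_eq0P (fun u _ => sumr_ge0 _ (fun w _ => ge0 u w)) S0.
  move=> /(_ x isT) /(psumr_eq0P (fun w _ => ge0 x w)) /(_ y isT) /eqP.
  by rewrite exy mul1r.
move=> x y; have cl : fingraph.closed e [pred z | phi 0 z == phi 0 x].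
  by move=> u w /edge_eq; rewrite !inE => ->.
have := closed_connect cl (e_conn x y); rewrite !inE eqxx => /esym/eqP.
by move=> ->.
Qed.

Variable lam : R.
Hypothesis lam_le : forall m : R, m != 0 -> laplacian_eigenvalue d e m -> lam <= m.

(** [L] minus [lam] times the orthogonal projection onto the functions of zero sum; its positivity
    encodes the spectral gap. *)
Let H : 'M[R[i]]_n := \matrix_(i, j)
  ((i == j)%:R - d%:R^-1 * (e i j)%:R - lam%:C * ((i == j)%:R - n%:R^-1)).

Let HE i j : H i j = L i j - lam%:C * ((i == j)%:R - n%:R^-1).
Proof. by rewrite LE /H mxE. Qed.

Let nn0 (i : 'I_n) : n%:R != 0 :> R[i].
Proof. by rewrite pnatr_eq0 -lt0n; apply: leq_ltn_trans (ltn_ord i). Qed.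

Let H_herm : H \is hermitianmx n false Num.conj.
Proof.
apply: realsym_hermsym.
  rewrite is_hermitianmxE expr0 scale1r map_mx_id //; apply/eqP/matrixP => i j.
  by rewrite !mxE eq_sym e_sym.
apply/mxOverP => i j; rewrite mxE.
by rewrite !(rpredB, rpredM, rpredV, realn) // complex_real.
Qed.

(** The rows of [H] sum to zero, so an eigenvector for [k < 0] has zero sum and is an eigenvector of
    [L] for [lam + k]. The gap leaves only [lam + k = 0], but then [phi] is constant with zero
    sum. *)
Let H_eig m : m \is Num.real -> eigenvalue H m -> 0 <= m.
Proof.
move=> /complex_realP[k ->{m}] /eigenvalueP[phi phiH phi0].
rewrite ler0c leNgt; apply/negP => k0.
have phiHE j : (phi *m H) 0 j = (phi *m L) 0 j - lam%:C * (phi 0 j - n%:R^-1 * \sum_i phi 0 i).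
  rewrite [LHS]mxE [(phi *m L) 0 j]mxE mulr_sumr.
  rewrite -[phi 0 j](_ : \sum_i phi 0 i * (i == j)%:R = _); last first.
    rewrite (bigD1 j) //= eqxx mulr1 big1 ?addr0 // => i /negbTE ->.
    by rewrite mulr0.
  rewrite -sumrB mulr_sumr -sumrB; apply: eq_bigr => i _; rewrite HE.
  rewrite mulrBr; congr (_ - _); rewrite mulrCA; congr (_ * _).
  by rewrite mulrBr [n%:R^-1 * _]mulrC.
have L1 : \sum_j (phi *m L) 0 j = 0.
  under eq_bigr do rewrite mxE.
  rewrite exchange_big big1 // => i _; rewrite -mulr_sumr.
  under eq_bigr do rewrite LE.
  rewrite sumrB -mulr_sumr sum_edges mulVf; last by rewrite pnatr_eq0 -lt0n.
  by rewrite (bigD1 i) //= eqxx big1 ?addr0 ?subrr ?mulr0 // => j; rewrite eq_sym => /negbTE ->.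
have s0 : \sum_i phi 0 i = 0.
  have : \sum_j (phi *m H) 0 j = 0.
    under eq_bigr do rewrite phiHE.
    rewrite sumrB L1 -mulr_sumr sub0r; apply/eqP; rewrite oppr_eq0; apply/eqP.
    rewrite [X in _ * X](_ : _ = 0) ?mulr0 // sumrB sumr_const card_ord -(mulr_natr (_ * _)).
    case: (posnP n) => [n0|n_gt0]; last first.
      by rewrite mulrAC mulVf ?mul1r ?subrr // pnatr_eq0 -lt0n.
    by rewrite big1 ?mulr0 ?mul0r ?subrr // => i _; have := ltn_ord i; rewrite {2}n0.
  rewrite phiH; under eq_bigr do rewrite mxE.
  rewrite -mulr_sumr => /eqP; rewrite mulf_eq0 => /orP[|/eqP //].
  by rewrite (inj_eq (@complexI _)) (lt_eqF k0).
have phiL : laplacian d e phi = (lam + k)%:C *: phi.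
  rewrite -mulL; apply/rowP => j; have := phiHE j; rewrite phiH s0 mulr0 subr0 [LHS]mxE => h.
  by rewrite [RHS]mxE rmorphD mulrDl h addrCA subrr addr0.
have eig : laplacian_eigenvalue d e (lam + k).
  by apply/eigenvalueP; exists phi => //; rewrite mulL.
have [lk0|lk0] := eqVneq (lam + k) 0; last first.
  by have := lam_le lk0 eig; rewrite leNgt gtrDl k0.
have /laplacian_ker phic : laplacian d e phi = 0 by rewrite phiL lk0 scale0r.
move/eqP: phi0; apply; apply/rowP => j; rewrite mxE.
move: s0; rewrite (eq_bigr (fun=> phi 0 j)) => [|i _]; last exact: phic.
rewrite sumr_const card_ord -mulr_natr => /eqP; rewrite mulf_eq0 (negbTE (nn0 j)) orbF.
by move/eqP.
Qed.

(** The form of [H] is evaluated at the indicator [a] of [A]; the edges inside [A] are traded for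
    those leaving it by counting all [d * #|A|] edge ends in [A]. *)
Lemma edge_expansion (A : {set 'I_n}) :
  lam * d%:R * #|A|%:R * (1 - #|A|%:R / n%:R) <=
  (\sum_(x in A) \sum_(y in ~: A) e x y)%:R.
Proof.
pose a : 'rV[R[i]]_n := \row_j (j \in A)%:R.
have := hermitian_psd a H_herm H_eig.
pose eAA := (\sum_(x in A) \sum_(y in A) e x y)%N.
have dA : (\sum_(x in A) \sum_(y in ~: A) e x y + eAA = d * #|A|)%N.
  rewrite /eAA -big_split /= mulnC -sum_nat_const; apply: eq_bigr => x _.
  have -> : d = (\sum_y e x y)%N.
    by rewrite -(e_reg x) -sum1_card big_mkcond.
  rewrite addnC [RHS](bigID (mem A)) /=; congr (_ + _)%N.
  by apply: eq_bigl => y; rewrite inE.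
have -> : \sum_i \sum_j a 0 i * H i j * (a 0 j)^*%R =
    (#|A|%:R - d%:R^-1 * eAA%:R - lam * (#|A|%:R - n%:R^-1 * (#|A|%:R * #|A|%:R)))%:C.
  rewrite !rmorphB !rmorphM /= !rmorphB !rmorphM !fmorphV !rmorph_nat.
  under eq_bigr => i _.
    rewrite (bigID (mem A)) /= [X in _ + X]big1; last first.
      by move=> j /negbTE jA; rewrite !mxE jA rmorph0 mulr0.
    under eq_bigr => j jA do rewrite !mxE jA rmorph1 mulr1.
    rewrite addr0 -mulr_sumr; over.
  rewrite (bigID (mem A)) /= [X in _ + X]big1; last first.
    by move=> i /negbTE ->; rewrite mul0r.
  under eq_bigr => i iA do rewrite iA mul1r.
  rewrite addr0.
  have delta i : i \in A -> \sum_(j in A) (i == j)%:R = 1 :> R[i].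
    move=> iA; rewrite (bigD1 i) //= eqxx big1 ?addr0 // => j /andP[_].
    by rewrite eq_sym => /negbTE ->.
  under eq_bigr => i iA do rewrite !sumrB -!mulr_sumr !sumrB delta // sumr_const.
  rewrite !sumrB -!mulr_sumr !sumrB !sumr_const /eAA natr_sum.
  congr (_ - _ * _ - _ * (_ - _)).
    by apply: eq_bigr => i _; rewrite natr_sum.
  by rewrite -mulrnA -natrM mulr_natr.
rewrite ler0c => h.
have d0 : 0 < d%:R :> R by rewrite ltr0n.
have /(congr1 (fun m => m%:R : R)) := dA; rewrite natrD natrM => dA'.
have {h} := mulr_ge0 (ltW d0) h.
have -> : d%:R * (#|A|%:R - d%:R^-1 * eAA%:R - lam * (#|A|%:R - n%:R^-1 * (#|A|%:R * #|A|%:R))) =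
   d%:R * #|A|%:R - eAA%:R - lam * d%:R * #|A|%:R * (1 - #|A|%:R / n%:R) :> R.
  rewrite !mulrBr mulVKf ?gt_eqF //; congr (_ - _).
  by rewrite mulr1; ring.
by rewrite -dA' addrK subr_ge0.
Qed.

End expansion.

(** * A large component after deleting vertices *)

Section large_component.
Variables (R : realType) (n d : nat) (e : rel 'I_n).
Hypotheses (e_sym : symmetric e) (e_reg : regular_graph d e) (d_gt0 : (0 < d)%N).
Hypothesis e_conn : connected_graph e.
Variable lam : R.
Hypothesis lam_le : forall m : R, m != 0 -> laplacian_eigenvalue d e m -> lam <= m.
Hypotheses (lam_gt0 : 0 < lam) (lam_le1 : lam <= 1).

Definition induced (X : {set 'I_n}) : rel 'I_n :=
  [rel x y | [&& e x y, x \in X & y \in X]].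

Lemma large_component (s : nat) (Z : {set 'I_n}) : (#|Z| <= s)%N ->
  6 * s%:R < lam * n%:R ->
  exists2 C : {set 'I_n}, (2 * s < #|C|)%N &
    [/\ C \subset ~: Z & {in C &, forall x y, connect (induced (~: Z)) x y}].
Proof.
move=> Zs sn; apply: contrapT => small.
pose eX := induced (~: Z).
have eX_sym : connect_sym eX.
  by apply: sym_connect_sym => x y; rewrite /eX /induced /= e_sym [(x \in _) && _]andbC.
(* The components are indexed by their roots; for every other [r] the set is empty, so sums may run
   over all [r]. *)
pose C r := [set x in ~: Z | fingraph.root eX x == r].
have Csmall r : (#|C r| <= 2 * s)%N.
  rewrite leqNgt; apply/negP => big; apply: small; exists (C r) => //.
  split; first by apply/fintype.subsetP => x; rewrite inE => /andP[].
  move=> x y; rewrite !inE => /andP[_ /eqP xr] /andP[_ /eqP yr].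
  by apply/(fingraph.rootP eX_sym); rewrite xr yr.
have n0 : 0 < n%:R :> R.
  by rewrite -(pmulr_rgt0 _ lam_gt0); apply: le_lt_trans sn; rewrite mulr_ge0.
have boundary r : (\sum_(x in C r) \sum_(y in ~: C r) e x y <=
    \sum_(x in C r) \sum_(y in Z) e x y)%N.
  apply: leq_sum => x; rewrite !inE => /andP[xZ /eqP xr].
  rewrite [leqRHS]big_mkcond [leqLHS]big_mkcond /=; apply: leq_sum => y _.
  rewrite !inE; have [yZ|yZ] := boolP (y \in Z); first by case: ifP.
  rewrite /=; case: ifP => // /eqP yr; case exy : (e x y) => //.
  case: yr; rewrite -xr; apply/esym/(fingraph.rootP eX_sym)/connect1.
  by rewrite /eX /induced /= exy !inE xZ yZ.
have sumC : (\sum_r #|C r| = n - #|Z|)%N.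
  have -> : (n - #|Z| = #|~: Z|)%N by rewrite [RHS]cardsCs finset.setCK card_ord.
  rewrite -sum1_card.
  rewrite [RHS](partition_big (fingraph.root eX) predT) //=; apply: eq_bigr => r _.
  by rewrite -sum1_card; apply: eq_bigl => x; rewrite !inE.
have sumZ : (\sum_r \sum_(x in C r) \sum_(y in Z) e x y <= d * #|Z|)%N.
  have -> : (\sum_r \sum_(x in C r) \sum_(y in Z) e x y =
      \sum_(x in ~: Z) \sum_(y in Z) e x y)%N.
    rewrite [RHS](partition_big (fingraph.root eX) predT) //=; apply: eq_bigr => r _.
    by apply: eq_bigl => x; rewrite !inE.
  rewrite exchange_big /= mulnC -sum_nat_const; apply: leq_sum => y _.
  rewrite -(e_reg y) -sum1_card [leqRHS]big_mkcond [leqLHS]big_mkcond /=.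
  by apply: leq_sum => x _; rewrite !inE e_sym; case: (e y x); case: (x \in Z).
have expC r : 2 / 3 * (lam * d%:R) * #|C r|%:R <=
    (\sum_(x in C r) \sum_(y in Z) e x y)%:R :> R.
  apply: le_trans (_ : _ <= (\sum_(x in C r) \sum_(y in ~: C r) e x y)%:R) _; last first.
    by rewrite ler_nat.
  apply: le_trans (edge_expansion e_sym e_reg d_gt0 e_conn lam_le (C r)).
  have c0 : 0 <= lam * d%:R * #|C r|%:R :> R by rewrite !mulr_ge0 // ltW.
  (* From [#|C r| <= 2 * s] and [6 * s < lam * n <= n]. *)
  have : 2 / 3 <= 1 - #|C r|%:R / n%:R :> R.
    have : #|C r|%:R <= 2 * s%:R :> R by rewrite -natrM ler_nat.
    have : lam * n%:R <= n%:R by rewrite ler_piMl // ltW.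
    move=> h1 h2; have : #|C r|%:R / n%:R <= 1 / 3 :> R by rewrite ler_pdivrMr //; lra.
    lra.
  move=> /(ler_wpM2l c0); lra.
have : \sum_r 2 / 3 * (lam * d%:R) * #|C r|%:R <= (d * #|Z|)%:R :> R.
  apply: le_trans (ler_sum _ (fun r _ => expC r)) _.
  by rewrite -natr_sum ler_nat.
rewrite -mulr_sumr -natr_sum sumC natrB ?natrM; last first.
  by apply: leq_trans (max_card _) _; rewrite card_ord.
have d0 : 0 < d%:R :> R by rewrite ltr0n.
have -> : 2 / 3 * (lam * d%:R) * (n%:R - #|Z|%:R) =
  d%:R * (2 / 3 * lam * (n%:R - #|Z|%:R)) by ring.
rewrite ler_pM2l // => le1.
have Zs' : #|Z|%:R <= s%:R :> R by rewrite ler_nat.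
have : lam * #|Z|%:R <= #|Z|%:R by rewrite ler_piMl.
have : 0 <= s%:R :> R by [].
(* Summing the expansion over all components gives [lam * n <= 5 / 2 * s], against
   [6 * s < lam * n]. *)
move: le1; rewrite mulrBr; lra.
Qed.

End large_component.

(** Double counting of adjacent ordered pairs: each edge is listed once but occurs in both
    orders. *)
Lemma card_edges n d (e : rel 'I_n) : simple_graph e -> regular_graph d e ->
  (#|{: edge e}| + #|{: edge e}| = d * n)%N.
Proof.
move=> [e_sym e_irr] e_reg.
pose lt := [pred p : 'I_n * 'I_n | e p.1 p.2 && (p.1 < p.2)%N].
have -> : (d * n = \sum_(x : 'I_n) \sum_y e x y)%N.
  rewrite mulnC -[n in LHS]card_ord -sum_nat_const; apply: eq_bigr => x _.
  by rewrite -(e_reg x) -sum1_card big_mkcond.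
have -> : #|{: edge e}| = (\sum_(x : 'I_n) \sum_y (e x y && (x < y)))%N.
  rewrite card_sig pair_big /= -sum1_card big_mkcond; apply: eq_bigr => p _.
  by rewrite inE; case: (_ && _).
rewrite [X in (_ + X)%N]exchange_big -big_split; apply: eq_bigr => x _.
rewrite -big_split; apply: eq_bigr => y _ /=; rewrite [e y x]e_sym.
by case: ltngtP => [||/val_inj ->]; rewrite ?andbT ?andbF ?addn0 ?add0n // e_irr.
Qed.

(** * Discrete measures and zeros of their transforms *)

Section measures.
Variable R : realType.
Implicit Types (mu nu : set R -> R[i]) (T : seq R) (Lambda Omega : R).

Lemma msupp_dirac_comb s (c : 'I_s -> R[i]) (t : 'I_s -> R) :
  msupp (dirac_comb c t) `<=` [set` [seq t j | j : 'I_s]].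
Proof.
move=> x; rewrite /msupp /= dirac_comb_set1; apply: contra_neqT => xt.
apply: big1 => j /eqP tj; case/negP: xt; apply/mapP; exists j; rewrite ?mem_enum //.
Qed.

Lemma sum_msupp (F : R -> R[i]) mu T : uniq T -> msupp mu `<=` [set` T] ->
  \sum_(x \in msupp mu) mu [set x] * F x = \sum_(x <- T) mu [set x] * F x.
Proof.
move=> uT muT; rewrite [RHS]fsbig_seq //; apply: (@fsbig_widen _ _ _ _ (msupp mu) [set` T]) => // x.
by move=> [_ /negP]; rewrite negbK => /eqP h; rewrite /= h mul0r.
Qed.

Lemma measure_atoms s (c : 'I_s -> R[i]) (t : 'I_s -> R) A : injective t ->
  dirac_comb c t A =
  \sum_(x \in msupp (dirac_comb c t))
     dirac_comb c t [set x] * (fine (\d_x A : \bar R))%:C.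
Proof.
move=> t_inj; rewrite (sum_msupp _ _ (@msupp_dirac_comb _ c t)); last first.
  by rewrite map_inj_uniq // enum_uniq.
rewrite big_map big_enum; apply: eq_bigr => j _.
by rewrite dirac_comb_set1 (eq_bigl (pred1 j)) ?big_pred1_eq // => k; apply: inj_eq.
Qed.

Lemma Sn_inj Lambda s mu : Sn Lambda s mu -> exists (c : 'I_s -> R[i]) (t : 'I_s -> R),
  [/\ injective t, forall j, 0 <= t j <= Lambda & mu = dirac_comb c t].
Proof.
move=> [c [t [t_lt tL ->]]]; exists c, t; split => // j k jk.
by case: (ltngtP j k) => [/t_lt|/t_lt|/val_inj //]; rewrite jk ltxx.
Qed.

Lemma Sn_msupp Lambda s mu : Sn Lambda s mu ->
  exists T, [/\ uniq T, (size T <= s)%N, msupp mu = [set` T] &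
                all (fun x => 0 <= x <= Lambda) T].
Proof.
move=> /Sn_inj[c [t [t_inj tL ->]]].
set E := [seq t j | j : 'I_s]; pose T := [seq x <- E | dirac_comb c t [set x] != 0].
have uE : uniq E by rewrite map_inj_uniq // enum_uniq.
exists T; split.
- exact: filter_uniq.
- by rewrite size_filter (leq_trans (count_size _ _)) // size_map size_enum_ord.
- apply/seteqP; split => x /=; rewrite mem_filter.
    by move=> x0; rewrite (msupp_dirac_comb x0) andbT.
  by move=> /andP[].
- by apply/allP => x; rewrite mem_filter => /andP[_ /mapP[j _ ->]].
Qed.

(** Reduces equality of set functions to singletons, since each measure is the sum of its atoms. *)
Lemma eq_measures Lambda1 s1 Lambda2 s2 mu nu (u : R[i]) : u != 0 ->
  Sn Lambda1 s1 mu -> Sn Lambda2 s2 nu ->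
  (forall x, nu [set x] = u * mu [set x]) -> nu = (fun A => u * mu A).
Proof.
move=> u0 mu_S nu_S atoms; have [T [uT _ TE _]] := Sn_msupp mu_S.
have suppE : msupp nu = [set` T].
  by rewrite -TE; apply/seteqP; split => x; rewrite /msupp /= atoms mulf_eq0 negb_or u0.
move: mu_S nu_S => /Sn_inj[c [t [t_inj _ muE]]] /Sn_inj[c' [t' [t'_inj _ nuE]]].
apply/funext => A; rewrite nuE muE !measure_atoms // -nuE -muE.
rewrite (@sum_msupp _ nu T) ?suppE // (@sum_msupp _ mu T) ?TE // mulr_sumr.
by apply: eq_bigr => x _; rewrite atoms mulrA.
Qed.

(** An instance of [expsum_zeros] with frequencies up to [2 * pi * Lambda] on an interval of length
    [2 * Omega], where [2 * Omega * Lambda < 1] is the required bound. *)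
Lemma fourier_zeros Lambda Omega n (v : 'I_n -> R) (V : {set 'I_n}) T (m : R -> R[i]) :
  0 < Omega -> 2 * Omega * Lambda < 1 ->
  injective v -> (forall j, - Omega <= v j <= Omega) ->
  uniq T -> all (fun x => 0 <= x <= Lambda) T -> (size T < #|V|)%N ->
  {in V, forall j, \sum_(x <- T) m x * cis (- (2 * pi * v j * x)) = 0} ->
  {in T, forall x, m x = 0}.
Proof.
move=> Omega0 OL v_inj v_int uT TL TV zeros.
pose l := [seq (m x, 2 * pi * x) | x <- sort <=%R T].
(* Reflecting the sample points absorbs the minus sign of the transform and keeps the frequencies
   nonnegative. *)
pose w := sort <=%R [seq - v j | j in V].
have pi0 : 0 < pi :> R by exact: pi_gt0.
have w_uniq : uniq w.
  by rewrite sort_uniq map_inj_in_uniq ?enum_uniq // => j k _ _ /oppr_inj /v_inj.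
have w_lt : sorted <%R w by rewrite lt_sorted_uniq_le w_uniq sort_le_sorted.
have w_int : {in w, forall y, - Omega <= y <= Omega}.
  move=> y; rewrite mem_sort => /mapP[j _ ->].
  by rewrite lerN2 lerNl andbC v_int.
have sz : (size T < size w)%N by rewrite size_sort size_map -cardE.
have w0 : all (fun y => expsum l y == 0) w.
  apply/allP => y; rewrite mem_sort => /mapP[j]; rewrite mem_enum => jV ->.
  rewrite /expsum big_map (perm_big T) ?perm_sort //= -[X in _ == X](zeros j jV).
  by apply/eqP; apply: eq_bigr => x _; congr (_ * cis _); ring.
suff : all (fun p => p.1 == 0) l.
  move=> /allP l0 x xT; apply/eqP; apply: (l0 (m x, 2 * pi * x)).
  by apply/mapP; exists x; rewrite ?mem_sort.
case: w w_uniq w_lt w_int sz w0 => // x0 xs _ w_lt w_int sz /= /andP[/eqP F0 Fxs].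
apply: (@expsum_zeros _ l (2 * pi * Lambda) (- Omega) Omega x0 xs) => //.
- rewrite -map_comp (sorted_map (f := fun x => 2 * pi * x)).
  apply: sub_sorted (_ : sorted <%R _); last first.
    by rewrite lt_sorted_uniq_le sort_uniq uT sort_le_sorted.
  by move=> x y /=; rewrite ltr_pM2l // mulr_gt0.
- apply/allP => p /mapP[x]; rewrite mem_sort => /(allP TL) /andP[x_ge0 xL] -> /=.
  have pi2 : 0 < 2 * pi :> R by rewrite mulr_gt0.
  by rewrite (mulr_ge0 (ltW pi2)) //= ler_pM2l.
- rewrite opprK.
  have -> : 2 * pi * Lambda * (Omega + Omega) = (2 * pi) * (2 * Omega * Lambda) by ring.
  by rewrite -[ltRHS]mulr1 ltr_pM2l // mulr_gt0.
- by have /andP[] := w_int x0 (mem_head _ _).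
- by have /andP[] := w_int _ (mem_last x0 xs).
- by rewrite size_map size_sort.
Qed.

End measures.

(** * Relative phases from magnitudes *)

Section phase.
Variable R : realType.

(** The third magnitude determines the real part of [a * b^*], the fourth its imaginary part. *)
Lemma polarization (a b a' b' : R[i]) :
  `|a| ^+ 2 = `|a'| ^+ 2 -> `|b| ^+ 2 = `|b'| ^+ 2 ->
  `|a - b| ^+ 2 = `|a' - b'| ^+ 2 ->
  `|a - 'i%C * b| ^+ 2 = `|a' - 'i%C * b'| ^+ 2 ->
  a * b^*%C = a' * b'^*%C.
Proof.
case: a b a' b' => a1 a2 [b1 b2] [a1' a2'] [b1' b2'].
rewrite -!add_Re2_Im2 /= => /complexI h1 /complexI h2 /complexI h3 /complexI h4.
by simpc; congr (_ +i* _); lra.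
Qed.

Lemma edge_ratio (a b a' b' : R[i]) : a' != 0 -> b' != 0 ->
  `|b| ^+ 2 = `|b'| ^+ 2 -> a * b^*%C = a' * b'^*%C -> a / a' = b / b'.
Proof.
move=> a0 b0; rewrite !sqr_normc => bb ab.
have bc0 : b'^*%C != 0 by rewrite conjc_eq0.
apply/eqP; rewrite eqr_div // -(inj_eq (mulIf bc0)); apply/eqP.
by rewrite -!mulrA -bb mulrCA ab.
Qed.

End phase.

(** * Propagation of the phase along the graph *)

Section measures_on_graph.
Variables (R : realType) (n : nat) (e : rel 'I_n).
Hypothesis e_sym : symmetric e.
Variables (v : 'I_n -> R) (f g : R -> R[i]).
Hypotheses (m0 : meas0 v f = meas0 v g) (m1 : meas1 v e f = meas1 v e g).
Hypothesis m2 : meas2 v e f = meas2 v e g.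

Lemma sqr_norm_vertex j : `|f (v j)| ^+ 2 = `|g (v j)| ^+ 2.
Proof. by have /ffunP/(_ j) := m0; rewrite !ffunE. Qed.

Lemma edge_product x y : e x y ->
  f (v x) * (f (v y))^*%C = g (v x) * (g (v y))^*%C.
Proof.
have lt_case (j k : 'I_n) : e j k -> (j < k)%N ->
    f (v j) * (f (v k))^*%C = g (v j) * (g (v k))^*%C.
  move=> ejk jk; have pP : e (j, k).1 (j, k).2 && ((j, k).1 < (j, k).2)%N by rewrite /= ejk.
  have /ffunP/(_ (exist _ (j, k) pP)) := m1; rewrite !ffunE /= => h1.
  have /ffunP/(_ (exist _ (j, k) pP)) := m2; rewrite !ffunE /= => h2.
  by apply: polarization => //; apply: sqr_norm_vertex.
move=> exy; case: (ltngtP x y) => [xy|yx|/val_inj xy]; first exact: lt_case.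
  (* The measurements list each edge in increasing order only; the other order follows by
     conjugation. *)
  rewrite e_sym in exy; have /(congr1 conjc) := lt_case _ _ exy yx.
  by rewrite !rmorphM /= !conjcK ![_^*%C * _]mulrC.
by rewrite xy -!sqr_normc sqr_norm_vertex.
Qed.

Lemma component_ratio (C : {set 'I_n}) :
  {in C &, forall x y, connect (induced e (~: [set j | g (v j) == 0])) x y} ->
  C \subset ~: [set j | g (v j) == 0] ->
  {in C &, forall x y, f (v y) / g (v y) = f (v x) / g (v x)}.
Proof.
move=> C_conn CZ x y xC yC.
have cl : fingraph.closed (induced e (~: [set j | g (v j) == 0]))
    [pred z | f (v z) / g (v z) == f (v x) / g (v x)].
  move=> z w /and3P[ezw]; rewrite !inE => z0 w0.
  by rewrite (edge_ratio z0 w0 (sqr_norm_vertex w) (edge_product ezw)).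
by have := closed_connect cl (C_conn x y xC yC); rewrite !inE eqxx => /esym/eqP.
Qed.

End measures_on_graph.

Theorem theorem3p11 (R : realType) (Lambda Omega : R) (s : nat)
    (mu : set R -> R[i]) (d n : nat) (v : 'I_n -> R) (e : rel 'I_n)
    (Lambda_gt0 : 0 < Lambda) (Omega_gt0 : 0 < Omega)
    (OmegaLambda : 2 * Omega * Lambda < 1)
    (s_gt0 : (0 < s)%N)
    (mu_S : Sall Lambda mu) (mu_supp : (msupp mu #= `I_s)%card)
    (d_ge3 : (3 <= d)%N)
    (v_inj : injective v) (v_int : forall j, - Omega <= v j <= Omega)
    (e_ram : ramanujan R d e)
    (n_large :
       6 * d%:R * (1 + 6 / ln (s%:R / (Lambda * Omega))) * s%:R
         / (d%:R - 2 * Num.sqrt (d%:R - 1)) < n%:R :> R) :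
  (n + #|{: edge e}| + #|{: edge e}| = d.+1 * n)%N /\
  forall nu : set R -> R[i],
    Sn Lambda s nu ->
    meas0 v (fourier nu) = meas0 v (fourier mu) ->
    meas1 v e (fourier nu) = meas1 v e (fourier mu) ->
    meas2 v e (fourier nu) = meas2 v e (fourier mu) ->
    exists2 u : R[i], `|u| = 1 & nu = (fun A => u * mu A).
Proof.
have [_ e_simple e_reg e_conn [l [_ _ l_min] lam_l]] := e_ram.
split; first by rewrite -addnA (card_edges e_simple e_reg) mulSn.
have d_gt0 : (0 < d)%N by exact: leq_trans d_ge3.
have [e_sym _] := e_simple.
(* The Ramanujan bound itself serves as spectral gap. *)
set lam := 1 - 2 * Num.sqrt (d%:R - 1) / d%:R in lam_l.
have lam_le m : m != 0 -> laplacian_eigenvalue d e m -> lam <= m.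
  by move=> m0 /(l_min _ m0); apply: le_trans.
have dR : 3 <= d%:R :> R by rewrite (ler_nat _ 3).
have dR0 : 0 < d%:R :> R by lra.
have sqrt_lt : 2 * Num.sqrt (d%:R - 1) < d%:R :> R.
  rewrite -(@ltr_pXn2r _ 2) ?nnegrE ?mulr_ge0 ?sqrtr_ge0 // ?ltW //.
  by rewrite exprMn sqr_sqrtr; nra.
have lamE : d%:R * lam = d%:R - 2 * Num.sqrt (d%:R - 1).
  by rewrite /lam; field; rewrite gt_eqF.
have lam_gt0 : 0 < lam by rewrite -(pmulr_rgt0 _ dR0) lamE subr_gt0.
have lam_le1 : lam <= 1 by rewrite gerBl divr_ge0 ?mulr_ge0 ?sqrtr_ge0 // ltW.
have s1 : 1 <= s%:R :> R by rewrite (ler_nat _ 1).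
(* Since [Lambda * Omega < 1 / 2] and [1 <= s], the logarithm is positive and the factor
   [1 + 6 / ln _] is at least 1. *)
have n_gt : 6 * s%:R < lam * n%:R.
  have LO : 0 < Lambda * Omega by rewrite mulr_gt0.
  have ln_gt0 : 0 < ln (s%:R / (Lambda * Omega)).
    by apply: ln_gt0; rewrite ltr_pdivlMr //; nra.
  have q0 : 0 <= 6 / ln (s%:R / (Lambda * Omega)) by rewrite divr_ge0 // ltW.
  move: n_large; rewrite -lamE ltr_pdivrMr ?mulr_gt0 //.
  set q := 6 / _ in q0 * => h; clearbody q; rewrite -(ltr_pM2l dR0).
  have : 0 <= 6 * d%:R * s%:R * q :> R by rewrite !mulr_ge0.
  lra.
case: mu_S => s' s'_gt0 mu_S.
have [T [uT _ TE TL]] := Sn_msupp mu_S.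
have sT : size T = s.
  move: mu_supp; rewrite TE => /card_fset_set <-.
  apply/perm_size/uniq_perm => //; first exact: finmap.fset_uniq.
  by move=> x; rewrite in_fset_set ?mem_setE //; exact: finite_seq.
move=> nu nu_S m0 m1 m2.
have [T' [uT' sT' TE' TL']] := Sn_msupp nu_S.
have F_mu w : fourier mu w = \sum_(x <- undup (T ++ T')) mu [set x] * cis (- (2 * pi * w * x)).
  rewrite /fourier (@sum_msupp _ (fun x => cis (- (2 * pi * w * x))) _ (undup (T ++ T')))
    ?undup_uniq // TE.
  by move=> x /=; rewrite mem_undup mem_cat => ->.
have F_nu w : fourier nu w = \sum_(x <- undup (T ++ T')) nu [set x] * cis (- (2 * pi * w * x)).
  rewrite /fourier (@sum_msupp _ (fun x => cis (- (2 * pi * w * x))) _ (undup (T ++ T')))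
    ?undup_uniq // TE'.
  by move=> x /=; rewrite mem_undup mem_cat orbC => ->.
pose Z : {set 'I_n} := [set j | fourier mu (v j) == 0]%SET.
(* More than [s] zeros would annihilate all atoms of [mu], whose support is nonempty. *)
have Zs : (#|Z| <= s)%N.
  rewrite leqNgt -sT; apply/negP => TZ.
  have mu0 : {in T, forall x, mu [set x] = 0}.
    apply: (fourier_zeros Omega_gt0 OmegaLambda v_inj v_int uT TL TZ) => j.
    rewrite inE => /eqP; rewrite /fourier (sum_msupp (fun x => cis (- (2 * pi * v j * x))) uT) //.
    by rewrite TE.
  case: T sT {F_mu F_nu TZ} TE mu0 {uT TL} => [s0|x T _ TE mu0].
    by rewrite -s0 in s_gt0.
  have : msupp mu x by rewrite TE /= mem_head.
  by rewrite /msupp /= mu0 ?mem_head ?eqxx.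
have [C sC [CZ C_conn]] :=
  large_component e_sym e_reg d_gt0 e_conn lam_le lam_gt0 lam_le1 Zs n_gt.
have [x0 x0C] : exists x, x \in C.
  by apply/set0Pn; rewrite -card_gt0 (leq_ltn_trans _ sC).
have g0 x : x \in C -> fourier mu (v x) != 0.
  by move=> /(fintype.subsetP CZ); rewrite !inE.
(* The ratio is the same on all of [C], and the vertex magnitudes make it unimodular. *)
pose u := fourier nu (v x0) / fourier mu (v x0).
have u1 : `|u| = 1.
  rewrite normf_div; have /eqP := sqr_norm_vertex m0 x0.
  rewrite eqrXn2 ?normr_ge0 // => /eqP ->.
  by rewrite divff // normr_eq0 g0.
exists u => //; have u0 : u != 0 by rewrite -normr_eq0 u1 oner_eq0.
apply: (eq_measures u0 mu_S nu_S) => x.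
have [xT|] := boolP (x \in undup (T ++ T')); last first.
  rewrite mem_undup mem_cat negb_or => /andP[xT xT'].
  have -> : mu [set x] = 0.
    by apply: contraNeq xT => mux; have : msupp mu x by []; rewrite TE.
  have -> : nu [set x] = 0; last by rewrite mulr0.
  by apply: contraNeq xT' => nux; have : msupp nu x by []; rewrite TE'.
(* The difference of [nu] and [u * mu] has at most [2 * s] atoms, while its transform vanishes at
   the more than [2 * s] vertices of [C]. *)
apply/eqP; rewrite -subr_eq0; apply/eqP; move: x xT.
apply: (fourier_zeros Omega_gt0 OmegaLambda v_inj v_int (V := C)
  (m := fun x => nu [set x] - u * mu [set x])) => //.
- exact: undup_uniq.
- by apply/allP => x; rewrite mem_undup mem_cat => /orP[/(allP TL)|/(allP TL')].
- apply: leq_ltn_trans (size_undup _) _; rewrite size_cat sT; apply: leq_ltn_trans sC.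
  by rewrite mul2n -addnn leq_add2l.
move=> j jC; under eq_bigr do rewrite mulrBl -(mulrA u).
rewrite sumrB -mulr_sumr -F_mu -F_nu /u.
rewrite -(component_ratio e_sym m0 m1 m2 C_conn CZ x0C jC) divfK ?subrr //.
exact: g0.
Qed.
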